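(* Let $\mathcal{F}$ be a free filter on $\omega$. If the Boolean algebra $\mathcal{A}_{\mathcal{F}}=\mathcal{F}\cup\mathcal{F}^*$ does not have the Nikodym property, then it does not have the Grothendieck property either.
   Context: A filter $\mathcal{F}$ on $\omega$ is free if $\bigcap\mathcal{F}=\emptyset$; $\mathcal{F}^*=\{\omega\setminus A\colon A\in\mathcal{F}\}$, and $\mathcal{A}_{\mathcal{F}}$ is the Boolean subalgebra of $\wp(\omega)$ generated by $\mathcal{F}$. For a Boolean algebra $\mathcal{A}$, $\mathrm{ba}(\mathcal{A})$ is the Banach space of finitely additive $\mu\colon\mathcal{A}\to\mathbb{R}$ with finite variation norm $\|\mu\|=\sup\{|\mu(A)|+|\mu(B)|\colon A\wedge B=0\}$. $\mathcal{A}$ has the Nikodym property if every sequence in $\mathrm{ba}(\mathcal{A})$ converging to $0$ at every element of $\mathcal{A}$ is norm bounded; it has the Grothendieck property if every norm bounded such sequence converges weakly to $0$ in $\mathrm{ba}(\mathcal{A})$. *)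

(* Defs.v *)
From HB Require Import structures.
From mathcomp Require Import all_boot all_order all_algebra.
From mathcomp Require Import all_classical all_reals.
From mathcomp Require Import topology normedtype sequences.

Set Implicit Arguments.
Unset Strict Implicit.
Unset Printing Implicit Defensive.

Import Order.Theory GRing.Theory Num.Theory.
Import numFieldNormedType.Exports.

Local Open Scope classical_set_scope.
Local Open Scope ring_scope.

(* Boolean algebras are the structures [ctbDistrLatticeType d]; the powerset
   [set T] is one, with set-theoretic operations. *)

Section generated_subalgebra.
Context {d : Order.disp_t} {B : ctbDistrLatticeType d}.

Definition bool_subalgebra (S : set B) : Prop :=
  [/\ S \bot%O,
      S \top%O,
      forall a b, S a -> S b -> S (a `&` b)%O,
      forall a b, S a -> S b -> S (a `|` b)%O &
      forall a, S a -> S (~` a)%O].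

Variable G : set B.

Definition gen_subalgebra : set B := smallest bool_subalgebra G.

Lemma gen_subalgebraP : bool_subalgebra gen_subalgebra.
Proof.
split.
- by move=> S [[]].
- by move=> S [[]].
- by move=> a b Sa Sb S SP; case: (SP) => -[_ _ h _ _] _; apply: h;
    [exact: Sa|exact: Sb].
- by move=> a b Sa Sb S SP; case: (SP) => -[_ _ _ h _] _; apply: h;
    [exact: Sa|exact: Sb].
- by move=> a Sa S SP; case: (SP) => -[_ _ _ _ h] _; apply: h; exact: Sa.
Qed.

Definition gen_pred : {pred B} := fun a => `[< gen_subalgebra a >].

Record genalg : Type := GenAlg
  { genalg_val :> B ; _ : genalg_val \in gen_pred }.

HB.instance Definition _ := [isSub for genalg_val].
HB.instance Definition _ := [Choice of genalg by <:].

Let genalgI : {in gen_pred &, forall a b, (a `&` b)%O \in gen_pred}.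
Proof.
move=> a b /asboolP Sa /asboolP Sb; apply/asboolP.
by have [_ _ h _ _] := gen_subalgebraP; exact: h.
Qed.

Let genalgU : {in gen_pred &, forall a b, (a `|` b)%O \in gen_pred}.
Proof.
move=> a b /asboolP Sa /asboolP Sb; apply/asboolP.
by have [_ _ _ h _] := gen_subalgebraP; exact: h.
Qed.

Let genalg0 : \bot%O \in gen_pred.
Proof. by apply/asboolP; have [] := gen_subalgebraP. Qed.

Let genalg1 : \top%O \in gen_pred.
Proof. by apply/asboolP; have [] := gen_subalgebraP. Qed.

HB.instance Definition _ := Order.SubChoice_isTBSubLattice.Build
  d B gen_pred d genalg genalgI genalgU genalg0 genalg1.

Lemma genalg_valI (a b : genalg) :
  genalg_val (a `&` b)%O = (genalg_val a `&` genalg_val b)%O.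
Proof. by []. Qed.

Lemma genalg_valU (a b : genalg) :
  genalg_val (a `|` b)%O = (genalg_val a `|` genalg_val b)%O.
Proof. by []. Qed.

Lemma genalg_val0 : genalg_val \bot%O = \bot%O. Proof. by []. Qed.

Lemma genalg_val1 : genalg_val \top%O = \top%O. Proof. by []. Qed.

Let genalg_meetUl : @left_distributive genalg genalg Order.meet Order.join.
Proof. by move=> a b c; apply: val_inj; exact: meetUl. Qed.

HB.instance Definition _ :=
  Order.Lattice_Meet_isDistrLattice.Build d genalg genalg_meetUl.

Let genalgC (a : genalg) : (~` (val a))%O \in gen_pred.
Proof.
apply/asboolP; have [_ _ _ _ h] := gen_subalgebraP.
by apply: h; exact/asboolP/(valP a).
Qed.

Definition genalg_compl (a : genalg) : genalg := GenAlg (genalgC a).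

Let genalg_joinxC (a : genalg) : (a `|` genalg_compl a)%O = \top%O.
Proof. by apply: val_inj; exact: joinxC. Qed.

Let genalg_meetxC (a : genalg) : (a `&` genalg_compl a)%O = \bot%O.
Proof. by apply: val_inj; exact: meetxC. Qed.

HB.instance Definition _ := Order.TBDistrLattice_hasComplement.Build
  d genalg genalg_joinxC genalg_meetxC.

Lemma genalg_valC (a : genalg) : genalg_val (~` a)%O = (~` (genalg_val a))%O.
Proof. by []. Qed.

End generated_subalgebra.

Section ba.
Context {R : realType} {d : Order.disp_t} {B : ctbDistrLatticeType d}.
Implicit Types mu nu : B -> R.

Definition finitely_additive mu : Prop :=
  forall a b, (a `&` b)%O = \bot%O -> mu (a `|` b)%O = mu a + mu b.

Definition variation_set mu : set R :=
  [set r | exists a b : B, (a `&` b)%O = \bot%O /\ r = `|mu a| + `|mu b|].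

Definition variation mu : R := sup (variation_set mu).

Definition ba_set : set (B -> R) :=
  [set mu | finitely_additive mu /\ has_ubound (variation_set mu)].

Definition ba_pred : {pred B -> R} := fun mu => `[< ba_set mu >].

Lemma variation_set_nonempty mu : variation_set mu !=set0.
Proof. by exists (`|mu \bot%O| + `|mu \bot%O|), \bot%O, \bot%O; rewrite meetxx. Qed.

Lemma variation_ub mu a b : ba_set mu -> (a `&` b)%O = \bot%O ->
  `|mu a| + `|mu b| <= variation mu.
Proof.
move=> [_ ub] ab; apply: sup_upper_bound; last by exists a, b.
by split=> //; exact: variation_set_nonempty.
Qed.

Lemma variation_le mu M :
  (forall a b, (a `&` b)%O = \bot%O -> `|mu a| + `|mu b| <= M) ->
  variation mu <= M.
Proof.
move=> h; apply: sup_le_ub; first exact: variation_set_nonempty.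
by move=> _ [a [b [ab ->]]]; exact: h.
Qed.

Lemma ba_submod_closed : submod_closed ba_pred.
Proof.
split.
  apply/asboolP; split; first by move=> a b _; rewrite /= addr0.
  by exists 0 => _ [a [b [_ ->]]]; rewrite normr0 addr0.
move=> c mu nu /asboolP muP /asboolP nuP; apply/asboolP; split.
  move=> a b ab; have [+ _] := muP; have [+ _] := nuP => nuD muD.
  by rewrite !fctE muD// nuD// scalerDr addrACA.
exists (`|c| * variation mu + variation nu) => _ [a [b [ab ->]]].
rewrite !fctE /= (le_trans (lerD (ler_normD _ _) (ler_normD _ _)))// addrACA.
have cE x : `|(c *: mu) x| = `|c| * `|mu x| by rewrite -normrM.
by rewrite lerD ?variation_ub// !cE -mulrDr ler_wpM2l// variation_ub.
Qed.

End ba.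

Record ba (R : realType) (d : Order.disp_t) (B : ctbDistrLatticeType d) :=
  Ba { ba_fun :> B -> R ; _ : ba_fun \in ba_pred }.

Section ba_normed.
Context {R : realType} {d : Order.disp_t} {B : ctbDistrLatticeType d}.
Local Notation ba := (ba R B).

HB.instance Definition _ := [isSub of ba for (@ba_fun R d B)].
HB.instance Definition _ := [Choice of ba by <:].

HB.instance Definition _ :=
  GRing.isSubmodClosed.Build R (B -> R) (@ba_pred R d B) ba_submod_closed.
HB.instance Definition _ := [SubChoice_isSubLmodule of ba by <:].

Implicit Types mu nu : ba.

Let baP mu : ba_set mu. Proof. exact/asboolP/(valP mu). Qed.

Lemma baDE mu nu a : (mu + nu) a = mu a + nu a. Proof. by []. Qed.

Lemma baZE (c : R) mu a : (c *: mu) a = c * mu a. Proof. by []. Qed.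

Definition ba_norm mu : R := variation mu.

Let ba_normD mu nu : ba_norm (mu + nu) <= ba_norm mu + ba_norm nu.
Proof.
rewrite /ba_norm; apply: variation_le => a b ab; rewrite !baDE.
rewrite (le_trans (lerD (ler_normD _ _) (ler_normD _ _)))// addrACA.
by rewrite lerD// variation_ub.
Qed.

Let ba_normZ_le (c : R) mu : ba_norm (c *: mu) <= `|c| * ba_norm mu.
Proof.
rewrite /ba_norm; apply: variation_le => a b ab; rewrite !baZE !normrM -mulrDr.
by rewrite ler_wpM2l// variation_ub.
Qed.

Let ba_normZ (c : R) mu : ba_norm (c *: mu) = `|c| * ba_norm mu.
Proof.
apply/eqP; rewrite eq_le ba_normZ_le /=.
have [->|c0] := eqVneq c 0.
  rewrite normr0 mul0r (le_trans _ (@variation_ub _ _ _ _ \bot%O \bot%O _ _))//.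
  - by rewrite addr_ge0.
  - by rewrite meetxx.
rewrite -ler_pdivlMl ?normr_gt0// -normfV.
by have := ba_normZ_le c^-1 (c *: mu); rewrite scalerA mulVf// scale1r.
Qed.

Let ba_norm0_eq0 mu : ba_norm mu = 0 -> mu = 0.
Proof.
move=> mu0; apply: val_inj; apply/funext => a /=.
have := @variation_ub _ _ _ mu a \bot%O (baP mu) (meetx0 _).
rewrite -/(ba_norm mu) mu0 => h; apply/eqP; rewrite -normr_le0.
by rewrite (le_trans _ h)// lerDl.
Qed.

HB.instance Definition _ :=
  Lmodule_isNormed.Build R ba ba_normD ba_normZ ba_norm0_eq0.

Lemma ba_normE mu : `|mu| = sup (variation_set mu). Proof. by []. Qed.

End ba_normed.

Section properties.
Context (R : realType) {d : Order.disp_t} (B : ctbDistrLatticeType d).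

Definition pointwise_null (mu : nat -> ba R B) : Prop :=
  forall a : B, mu n a @[n --> \oo] --> (0 : R).

Definition norm_bounded (mu : nat -> ba R B) : Prop :=
  exists M : R, forall n, `|mu n| <= M.

(* The dual of [ba R B] consists of the linear functionals that are continuous
   for the topology of the variation norm. *)
Definition weakly_null (mu : nat -> ba R B) : Prop :=
  forall phi : {linear ba R B -> R^o},
    continuous phi -> phi (mu n) @[n --> \oo] --> (0 : R^o).

Definition nikodym_property : Prop :=
  forall mu : nat -> ba R B, pointwise_null mu -> norm_bounded mu.

Definition grothendieck_property : Prop :=
  forall mu : nat -> ba R B,
    norm_bounded mu -> pointwise_null mu -> weakly_null mu.

End properties.

Definition free_filter (F : set_system nat) : Prop :=
  ProperFilter F /\ \bigcap_(A in F) A = set0.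

Definition dual_ideal (F : set_system nat) : set_system nat :=
  [set A | exists2 C, F C & A = ~` C].

Definition filter_algebra (F : set_system nat) : Type :=
  @genalg _ (set nat) F.
HB.instance Definition _ (F : set_system nat) :=
  Order.CTBDistrLattice.on (filter_algebra F).

Lemma filter_algebraE (F : set_system nat) : Filter F ->
  @gen_subalgebra _ (set nat) F = F `|` dual_ideal F.
Proof.
move=> FF; apply/seteqP; split; last first.
  have [_ _ _ _ h] := @gen_subalgebraP _ (set nat) F.
  move=> A [FA|[C FC ->]]; first exact: sub_gen_smallest.
  by apply: h; exact: sub_gen_smallest.
have dualE (A : set nat) : dual_ideal F A <-> F (~` A).
  by split=> [[C FC ->]|FA]; [rewrite setCK|exists (~` A) => //; rewrite setCK].
apply: smallest_sub; last by move=> A FA; left.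
split.
- by right; apply/dualE; rewrite setC0; exact: filterT.
- by left; exact: filterT.
- move=> A C [FA|/dualE FA] [FC|/dualE FC].
  + by left; exact: filterI.
  + right; apply/dualE; apply: filterS FC => x; rewrite /= => nC [_ /nC//].
  + right; apply/dualE; apply: filterS FA => x; rewrite /= => nA [/nA//].
  + right; apply/dualE; apply: filterS FC => x; rewrite /= => nC [_ /nC//].
- move=> A C [FA|/dualE FA] [FC|/dualE FC].
  + by left; apply: filterS FA => x; left.
  + by left; apply: filterS FA => x; left.
  + by left; apply: filterS FC => x; right.
  + right; apply/dualE; apply: filterS (filterI FA FC) => x [nA nC] [/nA|/nC] //.
- move=> A [FA|/dualE FA]; last by left.
  by right; apply/dualE; rewrite -complEset complK.
Qed.

(* Main.v *)
(** Let [mu] be pointwise null and norm unbounded on the algebra of [F]. Repeated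
    halving gives pairwise disjoint [a_j] and a subsequence [m_j] of [mu] with
    [|m_j (a_j)| >= 1]; at most one [a_j] lies in [F], so all may be taken in the
    dual ideal. For [A] in the dual ideal every subset of [A] is in the algebra,
    and Phillips' lemma on the powerset gives [m_j (A `&` a_j) --> 0]. Let [r_j]
    be the restriction of [m_j] to [a_j] and [delta] the two-valued measure of
    [F]: the measures [(r_j - r_j(1) delta) / |r_j|] are norm bounded and
    pointwise null. They are not weakly null: choosing [b_j <= a_j] that carries
    a fixed fraction of the norm of [r_j], the functional
    [nu |-> \sum_j sg (r_j (b_j)) nu (b_j)] stays away from 0 on them. *)

From HB Require Import structures.
Require Import Defs.
From mathcomp Require Import all_boot all_order all_algebra.
From mathcomp Require Import all_classical all_reals.
From mathcomp Require Import topology normedtype sequences.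
From mathcomp Require Import lra.

Set Implicit Arguments.
Unset Strict Implicit.
Unset Printing Implicit Defensive.

Import Order.Theory GRing.Theory Num.Theory.
Import numFieldNormedType.Exports.

Local Open Scope classical_set_scope.
Local Open Scope ring_scope.

(** * Finitely additive functions and their variation *)

Section additive.
Context {R : realType} {d : Order.disp_t} {B : ctbDistrLatticeType d}.
Implicit Types (mu : B -> R) (a b : B).

Lemma finitely_additive0 mu : finitely_additive mu -> mu \bot%O = 0.
Proof.
move=> muD; have := muD \bot%O \bot%O (meetxx _).
by rewrite joinxx => /eqP; rewrite -subr_eq0 opprD addNKr oppr_eq0 => /eqP.
Qed.

Lemma finitely_additive_split mu a b : finitely_additive mu ->
  mu b = mu (b `&` a)%O + mu (b `&` ~` a)%O.
Proof.
move=> muD; rewrite -muD -?meetUr ?joinxC ?meetx1//.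
by rewrite meetACA meetxC meetx0.
Qed.

Lemma norm_le_variation mu a : ba_set mu -> `|mu a| <= variation mu.
Proof.
by move=> muP; rewrite (le_trans _ (variation_ub muP (meetx0 a)))// lerDl.
Qed.

Lemma baP (mu : ba R B) : ba_set mu.
Proof. exact/asboolP/(valP mu). Qed.

(** Sorting the [a i] by the sign of [mu (a i)] and joining each class gives disjoint [P] and [Q]
    for which the sum equals [mu P - mu Q]. *)
Lemma sum_disjoint_le_variation mu (a : nat -> B) m : ba_set mu ->
  (forall i j, i != j -> (a i `&` a j)%O = \bot%O) ->
  \sum_(i < m) `|mu (a i)| <= variation mu.
Proof.
move=> muP a_disj; have [muD _] := muP.
(* Disjointness from the later [a j] is carried along so that [a m] can be joined to either
   class. *)
have [P [Q [PQ Pa Qa ->]]] : exists P Q : B, [/\ (P `&` Q)%O = \bot%O,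
    forall j, (m <= j)%N -> (P `&` a j)%O = \bot%O,
    forall j, (m <= j)%N -> (Q `&` a j)%O = \bot%O &
    \sum_(i < m) `|mu (a i)| = mu P - mu Q].
  elim: m => [|m [P [Q [PQ Pa Qa E]]]].
    exists \bot%O, \bot%O; split=> [|j _|j _|]; rewrite ?meet0x//.
    by rewrite big_ord0 subrr.
  have am j : (m < j)%N -> (a m `&` a j)%O = \bot%O.
    by move=> mj; apply: a_disj; rewrite neq_ltn mj.
  rewrite big_ord_recr/= E; have [mu0|mu0] := leP 0 (mu (a m)).
    exists (P `|` a m)%O, Q; split => [|j mj|j mj|].
    - by rewrite meetUl PQ [(a m `&` Q)%O]meetC Qa// joinxx.
    - by rewrite meetUl am// (Pa _ (ltnW mj)) joinxx.
    - by rewrite Qa// ltnW.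
    - by rewrite (muD _ _ (Pa _ (leqnn m))) addrAC ger0_norm.
  exists P, (Q `|` a m)%O; split => [|j mj|j mj|].
  - by rewrite meetUr PQ Pa// joinxx.
  - by rewrite Pa// ltnW.
  - by rewrite meetUl am// (Qa _ (ltnW mj)) joinxx.
  - by rewrite (muD _ _ (Qa _ (leqnn m))) opprD addrA ltr0_norm.
rewrite (le_trans _ (variation_ub muP PQ))// (le_trans (ler_norm _))//.
exact: ler_normB.
Qed.

End additive.

(** Serves both to restrict a measure to an element and to transfer measures from the filter algebra
    to the powerset. *)
Lemma ba_set_comp (R : realType) (d d' : Order.disp_t)
    (B : ctbDistrLatticeType d) (C : ctbDistrLatticeType d')
    (h : C -> B) (mu : B -> R) :
  (forall a b, (a `&` b)%O = \bot%O -> (h a `&` h b)%O = \bot%O) ->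
  (forall a b, h (a `|` b)%O = (h a `|` h b)%O) ->
  ba_set mu -> ba_set (mu \o h).
Proof.
move=> hI hU muP; have [muD _] := muP; split.
  by move=> a b ab; rewrite /= hU muD// hI.
by exists (variation mu) => _ [a [b [ab ->]]]; exact: variation_ub (hI _ _ ab).
Qed.

Lemma homo_ltn_geq (f : nat -> nat) : {homo f : m n / (m < n)%N} ->
  forall n, (n <= f n)%N.
Proof.
by move=> fI; elim=> // n ih; rewrite (leq_ltn_trans ih)// fI.
Qed.

Lemma homo_ltn_cvg (f : nat -> nat) : {homo f : m n / (m < n)%N} ->
  f @ \oo --> \oo.
Proof.
move=> fI A [N _ NA]; exists N => // n /= Nn; apply: NA => /=.
exact: leq_trans Nn (homo_ltn_geq fI n).
Qed.

(** * Disjoint elements extracted from an unbounded sequence *)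

Section disjoint_extraction.
Context {R : realType} {d : Order.disp_t} {B : ctbDistrLatticeType d}.
Variable mu : nat -> ba R B.

Let unbounded_below (X : B) := forall C : R,
  exists n a, (a <= X)%O /\ C < `|mu n a|.

Let unbounded_belowT : ~ norm_bounded mu -> unbounded_below \top%O.
Proof.
move=> nb C; apply: contrapT => h; apply: nb; exists (C + C) => n.
apply: variation_le => a b _.
have le_C c : `|mu n c| <= C.
  by rewrite leNgt; apply/negP => ?; apply: h; exists n, c; rewrite lex1.
exact: lerD.
Qed.

Let unbounded_below_split (X a : B) : unbounded_below X ->
  unbounded_below (X `&` a)%O \/ unbounded_below (X `&` ~` a)%O.
Proof.
move=> Xu; apply: contrapT => /not_orP[/existsNP[C1 h1] /existsNP[C2 h2]].
have [n [b [bX]]] := Xu (C1 + C2); apply/negP; rewrite -leNgt.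
have [muD _] := baP (mu n).
rewrite (finitely_additive_split a b muD) (le_trans (ler_normD _ _))// lerD//.
  rewrite leNgt; apply/negP => ?; apply: h1; exists n, (b `&` a)%O.
  by rewrite leI2.
rewrite leNgt; apply/negP => ?; apply: h2; exists n, (b `&` ~` a)%O.
by rewrite leI2.
Qed.

Let unbounded_below_step (X : B) (N : nat) :
    pointwise_null mu -> unbounded_below X ->
  exists n a, [/\ (N < n)%N, (a <= X)%O, unbounded_below a
    & 1 <= `|mu n (X `&` ~` a)%O|].
Proof.
move=> mu0 Xu.
have [C0 HC0] : exists C0, forall n, `|mu n X| <= C0.
  have cvgX : cvgn (fun n => mu n X) by apply/cvg_ex; exists 0; exact: mu0.
  have [M [_ HM]] := cvg_seq_bounded cvgX.
  by exists (M + 1) => n; apply: HM => //; rewrite ltrDl.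
(* The sum of norms rules out [n <= N]; the term [C0 + 1] makes [mu n] at least 1 in absolute value
   on both [b] and its complement in [X]. *)
have [n [b [bX]]] := Xu (C0 + 1 + \sum_(i < N.+1) `|mu i|).
have C00 : 0 <= C0 by rewrite (le_trans _ (HC0 0%N)).
have S0 : 0 <= \sum_(i < N.+1) `|mu i| by apply: sumr_ge0.
move=> hb.
have Nn : (N < n)%N.
  rewrite ltnNge; apply/negP => nN; move: hb; apply/negP; rewrite -leNgt.
  rewrite (le_trans (norm_le_variation b (baP (mu n))))//.
  have nN1 : (n < N.+1)%N by [].
  rewrite (bigD1 (Ordinal nN1))//= addrCA ler_wpDr// addr_ge0 ?addr_ge0//.
  by apply: sumr_ge0.
have [muD _] := baP (mu n).
have b1 : C0 + 1 < `|mu n b| by rewrite (le_lt_trans _ hb)// lerDl.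
have XbE : mu n (X `&` ~` b)%O = mu n X - mu n b.
  by rewrite (finitely_additive_split b X muD) (meet_idPr bX) addrAC subrr add0r.
have cb1 : 1 <= `|mu n (X `&` ~` b)%O|.
  rewrite XbE distrC (le_trans _ (lerB_dist _ _))// lerBrDr.
  by rewrite (le_trans _ (ltW b1))// addrC lerD2r.
have [] := unbounded_below_split b Xu; rewrite ?(meet_idPr bX) => bu.
  by exists n, b.
(* Here the complement of [b] in [X] carries the unboundedness, and the piece split off is [b]
   itself. *)
exists n, (X `&` ~` b)%O; split => //; first exact: leIl.
rewrite complI complK meetUr meetxC join0x (meet_idPr bX).
by rewrite (le_trans _ (ltW b1))// lerDr.
Qed.

(* Among the two pieces of a splitting on which [mu n] is large, one is kept as
   the next element of the sequence and the other carries the unboundedness. *)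
Lemma unbounded_disjoint_sequence : pointwise_null mu -> ~ norm_bounded mu ->
  exists (s : nat -> nat) (a : nat -> B),
    [/\ {homo s : m n / (m < n)%N},
        forall i j, i != j -> (a i `&` a j)%O = \bot%O &
        forall j, 1 <= `|mu (s j) (a j)|].
Proof.
move=> mu0 nb.
pose T := {p : nat * B | unbounded_below p.2}.
pose rel (p q : T) := [/\ ((sval p).1 < (sval q).1)%N,
  ((sval q).2 <= (sval p).2)%O &
  1 <= `|mu (sval q).1 ((sval p).2 `&` ~` (sval q).2)%O|].
have step (p : T) : {q : T | rel p q}.
  apply: cid; case: p => -[N X] /= Xu.
  have [n [a [Nn aX au na]]] := unbounded_below_step N mu0 Xu.
  by exists (exist _ (n, a) au).
have p0 : T by exists (0%N, \top%O); exact: unbounded_belowT.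
have [f [_ fS]] := dependent_choice step p0.
pose s n := (sval (f n)).1; pose X n := (sval (f n)).2.
have XS m n : (m <= n)%N -> (X n <= X m)%O.
  apply: (homo_leq (r := fun x y => (y <= x)%O)) => //.
    by move=> x y z yx zy; apply: le_trans yx.
  by move=> i; have [] := fS i.
(* The index is shifted because the measure that is large on the piece between [X j] and [X j.+1]
   was chosen together with [X j.+1]. *)
exists (s \o S), (fun j => (X j `&` ~` X j.+1)%O); split.
- have sI : {homo s : m n / (m < n)%N}.
    by apply: homo_ltn => [|i]; [exact: ltn_trans|have [] := fS i].
  by move=> m n mn; apply: sI.
- have dis i j : (i < j)%N ->
      ((X i `&` ~` X i.+1) `&` (X j `&` ~` X j.+1))%O = \bot%O.
    move=> ij; apply/eqP; rewrite -lex0.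
    rewrite (le_trans (leI2 (leIr _ _) (leIl _ _)))//.
    by rewrite (le_trans (leI2 (lexx _) (XS _ _ ij)))// meetC meetxC.
  move=> i j; rewrite neq_ltn => /orP[|] ij; first exact: dis.
  by rewrite meetC dis.
- by move=> j; have [] := fS j.
Qed.

End disjoint_extraction.

(** * Phillips' lemma on the powerset of the natural numbers *)

Section phillips.
Context {R : realType}.
Implicit Types lam : set nat -> R.

(* The subsequences [f (2 ^ i * (2 * n + 1))] have pairwise disjoint ranges, so
   a bounded additive function is small on all but finitely many of them. *)
Lemma small_on_subsequence lam (f : nat -> nat) (e : R) :
    ba_set lam -> {homo f : m n / (m < n)%N} -> 0 < e ->
  exists g : nat -> nat, [/\ {homo g : m n / (m < n)%N}, range g `<=` range f &
    forall S, S `<=` range g -> `|lam S| <= e].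
Proof.
move=> lamP fI e0; apply: contrapT => nex.
pose p i n := (2 ^ i * n.*2.+1)%N.
have pI i : {homo p i : m n / (m < n)%N}.
  by move=> m n mn; rewrite ltn_pmul2l ?expn_gt0// ltnS ltn_double.
have logp i n : logn 2 (p i n) = i.
  by rewrite lognM ?expn_gt0// pfactorK// logn_coprime ?addn0//= coprime2n/= odd_double.
have f_inj : injective f.
  by move=> m n E; have [/fI|/fI|//] := ltngtP m n; rewrite E ltnn.
have /choice[S SP] i : exists S, S `<=` range (f \o p i) /\ e < `|lam S|.
  apply: contrapT => nS; apply: nex; exists (f \o p i); split.
  - by move=> m n mn; apply/fI/pI.
  - by move=> _ [n _ <-]; exists (p i n).
  - move=> S Sp; rewrite leNgt; apply/negP => ?; apply: nS; exists S; split => //.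
have Sdisj i j : i != j -> (S i `&` S j)%O = \bot%O.
  move=> /eqP ij; rewrite -subset0 => x [].
  move=> /(SP i).1[m _ <-] /(SP j).1[n _ /= /f_inj E].
  by apply: ij; rewrite -(logp i m) -(logp j n) E.
pose m := (Num.truncn (variation lam / e)).+1.
have := sum_disjoint_le_variation m lamP Sdisj; apply/negP; rewrite -ltNge.
rewrite (@lt_le_trans _ _ (\sum_(i < m) e))//.
  by rewrite sumr_const card_ord -mulr_natl -ltr_pdivrMr// truncnS_gt.
by apply: ler_sum => i _; apply/ltW/(SP i).2.
Qed.

(* Phillips' lemma, by a gliding hump: a set [M = {k_0 < k_1 < ...}] is chosen
   so that [lam k_i] is small on [{k_0, ..., k_(i-1)}] and on every subset of
   [{k_(i+1), ...}]. *)
Lemma phillips_diagonal (lam : nat -> set nat -> R) :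
    (forall n, ba_set (lam n)) ->
    (forall M, lam n M @[n --> \oo] --> (0 : R)) ->
  lam n [set n] @[n --> \oo] --> (0 : R).
Proof.
move=> lamP lam0; apply: contrapT => ncvg.
have [e e0 He] : exists2 e : R, 0 < e &
    forall N, exists2 n, (N < n)%N & e <= `|lam n [set n]|.
  apply: contrapT => h; apply: ncvg; apply/cvgr0Pnorm_lt => e e0.
  apply: contrapT => nh; apply: h; exists e => // N.
  apply: contrapT => nn; apply: nh; exists N.+1 => // n /= Nn.
  by rewrite ltNge; apply/negP => ?; apply: nn; exists n.
have [f0 f0I f0e] : exists2 f : nat -> nat,
    {homo f : m n / (m < n)%N} & forall n, e <= `|lam (f n) [set f n]|.
  have step (m : nat) : {n | (m < n)%N /\ e <= `|lam n [set n]|}.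
    by apply: cid; have [n mn en] := He m; exists n.
  have [f [_ /all_and2[fS fe]]] := dependent_choice step 0%N.
  exists (f \o S) => // m n mn; apply: (homo_ltn ltn_trans fS).
  by rewrite ltnS.
(* The points before and after [k_i] will cost at most [c] each, which leaves [e / 2] of the value
   at [k_i]. *)
pose c := e / 4.
have c0 : 0 < c by rewrite divr_gt0.
(* A state is the last chosen point, the finite set of the points chosen before
   it, and a subsequence from which the later points are to be taken. *)
pose T := {p : nat * set nat * (nat -> nat) |
  [/\ {homo p.2 : m n / (m < n)%N}, range p.2 `<=` range f0,
      p.1.2 `<=` [set i | (i < p.1.1)%N],
      e <= `|lam p.1.1 [set p.1.1]| &
      `|lam p.1.1 p.1.2| <= c /\
      forall S, S `<=` range p.2 -> `|lam p.1.1 S| <= c]}.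
pose k (t : T) := (sval t).1.1.
pose E (t : T) := (sval t).1.2.
pose f (t : T) := (sval t).2.
have point (g : nat -> nat) (D : set nat) (K : nat) :
    {homo g : m n / (m < n)%N} -> range g `<=` range f0 ->
    D `<=` [set i | (i < K)%N] ->
  exists t : T, [/\ (K <= k t)%N, E t = D, range g (k t) &
                  range (f t) `<=` range g].
  move=> gI gf DK.
  have /cvgr0Pnorm_le/(_ c c0)[N _ HN] := lam0 D.
  (* Passing [K] keeps the points increasing; passing [N] makes [lam n] small on the set [D] of
     earlier points. *)
  pose n := g (maxn K N); have nmax : (maxn K N <= n)%N by exact: homo_ltn_geq.
  have [h [hI hg hc]] := small_on_subsequence (lamP n) gI c0.
  have nP : [/\ {homo h : m n / (m < n)%N}, range h `<=` range f0,
      D `<=` [set i | (i < n)%N], e <= `|lam n [set n]| &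
      `|lam n D| <= c /\ forall S, S `<=` range h -> `|lam n S| <= c].
    split => //.
    - by move=> x /hg/gf.
    - move=> i /DK /= iK; rewrite (leq_trans iK)// (leq_trans _ nmax)//.
      exact: leq_maxl.
    - by have [j _ <-] : range f0 n by apply: gf; exists (maxn K N).
    - by split => //; apply: HN => /=; rewrite (leq_trans _ nmax)// leq_maxr.
  exists (exist _ (n, D, h) nP); split => //=.
    by rewrite (leq_trans _ nmax)// leq_maxl.
  by exists (maxn K N).
have [t0 _] : exists t : T, True.
  by have [//|t _] := point f0 set0 0%N f0I (@subset_refl _ _); exists t.
pose rel (t u : T) := [/\ (k t < k u)%N, E u = E t `|` [set k t],
  range (f t) (k u) & range (f u) `<=` range (f t)].
have step (t : T) : {u | rel t u}.
  apply: cid; case: (svalP t) => tI tf tE _ _.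
  have [|u [ku Eu fu ff]] := point (f t) (E t `|` [set k t]) (k t).+1 tI tf.
    by move=> i [/tE /= ik|/= ->]; rewrite ltnS// ltnW.
  by exists u.
have [u [_ uS]] := dependent_choice step t0.
pose M := \bigcup_i E (u i).
have kI : {homo k \o u : m n / (m < n)%N}.
  by apply: homo_ltn => [|i]; [exact: ltn_trans|have [] := uS i].
have rangeS i j : (i <= j)%N -> range (f (u j)) `<=` range (f (u i)).
  elim: j => [|j ih]; first by rewrite leqn0 => /eqP->.
  rewrite leq_eqVlt ltnS => /predU1P[->//|/ih ij].
  by have [_ _ _ uf] := uS j; exact: subset_trans uf ij.
have ES i j : (i <= j)%N -> E (u i) `<=` E (u j).
  elim: j => [|j ih]; first by rewrite leqn0 => /eqP->.
  rewrite leq_eqVlt ltnS => /predU1P[->//|/ih ij].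
  by have [_ -> _ _] := uS j; exact: subset_trans ij (@subsetUl _ _ _).
have Ek i : E (u i.+1) = E (u i) `|` [set k (u i)] by have [] := uS i.
(* What remains of [M] consists of points chosen after stage [i], all drawn from the subsequence
   fixed at that stage, so the tail bound applies. *)
have later i : M `\` E (u i.+1) `<=` range (f (u i)).
  move=> x [[j _ +] nEx]; elim: j => [/(ES 0%N i.+1 isT)//|j ih].
  rewrite Ek => -[/ih//|/= xk].
  have [ji|ij] := leqP j i.
    by case: nEx; apply: (ES j.+1 i.+1) => //; rewrite Ek; right.
  case: j ij xk {ih} => // j; rewrite ltnS => ij ->.
  by have [_ _ fk _] := uS j; exact: rangeS ij _ fk.
have EM i : E (u i) `<=` M by move=> x Ex; exists i.
have split_M i : lam (k (u i)) M = lam (k (u i)) (E (u i)) +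
    lam (k (u i)) [set k (u i)] +
    lam (k (u i)) (M `\` E (u i.+1)).
  have [muD _] := lamP (k (u i)).
  have [_ _ Elt _ _] := svalP (u i).
  rewrite -muD; last first.
    rewrite -subset0 => x [/Elt /= xk xE]; move: xk.
    by rewrite -[(sval (u i)).1.1]/(k (u i)) -xE ltnn.
  rewrite joinEset -Ek -muD; last by rewrite -subset0 => x [h [_]].
  congr (lam _ _); rewrite joinEset setDE setUIr setUCr setIT.
  by apply/esym/setUidr/EM.
have big i : e / 2 <= `|lam (k (u i)) M|.
  have [_ _ _ ek [Ec fc]] := svalP (u i).
  rewrite split_M.
  have tail : `|lam (k (u i)) (M `\` E (u i.+1))| <= c.
    exact: fc.
  rewrite addrAC addrC (le_trans _ (lerB_normD _ _))// lerBrDr.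
  rewrite (le_trans _ ek)// (le_trans (lerD (lexx _) (ler_normD _ _)))//.
  rewrite (le_trans (lerD (lexx _) (lerD Ec tail)))//.
  by rewrite /c; lra.
(* The lower bound along [k (u i)] contradicts convergence at the single set [M]. *)
have /cvgr0Pnorm_lt/(_ (e / 2))[|N _ HN] := lam0 M.
  by rewrite divr_gt0.
have := big N; apply/negP; rewrite -ltNge; apply: HN => /=.
exact: homo_ltn_geq kI N.
Qed.

End phillips.

(** * Functionals given by series, and elements carrying a share of the norm *)

(** By disjointness the absolute partial sums are at most the norm of [nu]; the series thus
    converges and the functional has norm at most 1. *)
Lemma disjoint_series_functional (R : realType) (d : Order.disp_t)
    (B : ctbDistrLatticeType d) (b : nat -> B) (c : nat -> R) :
  (forall i j, i != j -> (b i `&` b j)%O = \bot%O) ->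
  (forall j, `|c j| <= 1) ->
  exists2 phi : {linear ba R B -> R^o}, continuous phi &
    forall nu : ba R B, phi nu = limn (series (fun j => c j * nu (b j))).
Proof.
move=> b_disj c1.
pose u (nu : ba R B) : R ^nat := fun j => c j * nu (b j).
have u_le nu n : [normed series (u nu)] n <= `|nu|.
  have := sum_disjoint_le_variation n (baP nu) b_disj.
  apply: le_trans; rewrite /= seriesEord/=.
  by apply: ler_sum => i _; rewrite normrM ler_piMl.
have u_ncvg nu : cvgn [normed series (u nu)].
  apply: nondecreasing_is_cvgn.
    by apply: nondecreasing_series => n _ _ /=.
  by exists `|nu| => _ [n _ <-]; exact: u_le.
have u_cvg nu : cvgn (series (u nu)) by exact: normed_cvg.
pose phi (nu : ba R B) : R^o := limn (series (u nu)).
have phiL : linear phi.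
  move=> k nu eta; rewrite /phi -lim_seriesZ// -lim_seriesD//; last first.
    exact: is_cvg_seriesZ.
  congr (limn (series _)); apply/funext => j.
  by rewrite /u !fctE baDE baZE mulrDr mulrCA.
pose phiM := GRing.isLinear.Build R (ba R B) R^o *:%R phi phiL.
pose phil : {linear ba R B -> R^o} := HB.pack phi phiM.
exists phil => //; apply: bounded_linear_continuous; apply/linear_boundedP.
near=> r => nu; rewrite (@le_trans _ _ (1 * `|nu|))//; last first.
  by rewrite ler_wpM2r//; near: r; exact: nbhs_pinfty_ge.
rewrite mul1r /= /phi (le_trans (lim_series_norm (u_ncvg nu)))//.
by apply: limr_le => //; near=> n; exact: u_le.
Unshelve. all: by end_near. Qed.

(** The norm is a supremum of sums of two values. One quarter, rather than one half, leaves slack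
    for a supremum that is not attained. *)
Lemma ba_quarter_norm_attained (R : realType) (d : Order.disp_t)
    (B : ctbDistrLatticeType d) (mu : ba R B) :
  exists a, `|mu| / 4 <= `|mu a|.
Proof.
have [mu0|mu0] := leP `|mu| 0.
  by exists \bot%O; have := normr_ge0 (mu \bot%O); lra.
apply: contrapT => /forallNP h.
have : `|mu| <= `|mu| / 2.
  apply: variation_le => a b _.
  have ha c : `|mu c| <= `|mu| / 4 by rewrite leNgt; apply/negP => /ltW/h.
  by rewrite (le_trans (lerD (ha a) (ha b)))//; lra.
by lra.
Qed.

(** * Measures on the filter algebra *)

Section filter_algebra.
Context {R : realType} {F : set_system nat}.
Hypothesis FF : ProperFilter F.
Local Notation AF := (filter_algebra F).
Implicit Types A B : AF.

Lemma filter_algebra_cases A : F (genalg_val A) \/ F (~` genalg_val A).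
Proof.
have /asboolP : genalg_val A \in gen_pred F by exact: (valP A).
rewrite filter_algebraE => -[|[C FC ->]]; first by left.
by right; rewrite setCK.
Qed.

Lemma filter_disjoint (X Y : set nat) : X `&` Y = set0 -> F X -> ~ F Y.
Proof.
by move=> XY FX FY; apply: (@filter_not_empty _ F); rewrite -XY; exact: filterI.
Qed.

(** The value [\bot] is a default for sets outside the algebra; sets of the dual ideal are
    represented faithfully. *)
Definition ideal_elt (X : set nat) : AF := insubd (\bot%O : AF) X.

Lemma ideal_eltK (X : set nat) : F (~` X) -> genalg_val (ideal_elt X) = X.
Proof.
move=> FX; apply: insubdK; apply/asboolP; rewrite filter_algebraE; right.
by exists (~` X) => //; rewrite setCK.
Qed.

Definition filter_charge A : R := (`[< F (genalg_val A) >])%:R.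

(** Disjoint sets are never both in [F]. If neither is, both complements are, and so is the
    complement of the union. *)
Lemma filter_charge_ba : ba_set filter_charge.
Proof.
split=> [A B AB|]; last first.
  exists 2 => _ [A [B [_ ->]]]; rewrite /filter_charge !normr_nat -natrD ler_nat.
  by do 2 case: asboolP.
have AB0 : genalg_val A `&` genalg_val B = set0.
  by have := congr1 (@genalg_val _ _ F) AB.
rewrite /filter_charge genalg_valU joinEset -natrD; congr (_%:R).
case: (asboolP (F (genalg_val A))) => FA.
  case: (asboolP (F (genalg_val B))) => [FB|_].
    by have := filter_disjoint AB0 FA FB.
  by rewrite asboolT//; apply: filterS FA => x; left.
case: (asboolP (F (genalg_val B))) => FB.
  by rewrite asboolT//; apply: filterS FB => x; right.
rewrite asboolF// => FAB.
have [//|FcA] := filter_algebra_cases A.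
have [//|FcB] := filter_algebra_cases B.
apply: filter_disjoint FAB (filterI FcA FcB).
by rewrite -setCU setICr.
Qed.

Definition filter_ba : ba R AF := @Ba R _ AF filter_charge (asboolT filter_charge_ba).

Lemma restr_ba_set (mu : ba R AF) A : ba_set (fun B => mu (B `&` A)%O).
Proof.
apply: (@ba_set_comp _ _ _ _ _ (fun B => (B `&` A)%O)); last exact: baP.
  by move=> B C BC; rewrite meetACA BC meet0x.
by move=> B C; rewrite meetUl.
Qed.

Definition restr_ba (mu : ba R AF) A : ba R AF :=
  @Ba R _ AF _ (asboolT (restr_ba_set mu A)).

(** All subsets of [A] lie in the algebra, so [m j] can be evaluated on the part of [A] inside the
    union of the [a i] for [i] in any set [M]. This gives measures on the powerset, whose diagonal
    Phillips' lemma controls. *)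
Lemma disjoint_diagonal_null (m : nat -> ba R AF) (a : nat -> AF) A :
    pointwise_null m ->
    (forall i j, i != j -> (a i `&` a j)%O = \bot%O) ->
    F (~` genalg_val A) ->
  m j (A `&` a j)%O @[j --> \oo] --> (0 : R).
Proof.
move=> m0 a_disj FA.
pose h (M : set nat) :=
  ideal_elt (genalg_val A `&` \bigcup_(i in M) genalg_val (a i)).
have hK M : genalg_val (h M) =
    genalg_val A `&` \bigcup_(i in M) genalg_val (a i).
  by apply: ideal_eltK; apply: filterS FA => x nA [].
have hP j : ba_set (m j \o h).
  apply: ba_set_comp (baP _) => [M N MN|M N]; apply: val_inj.
    rewrite -[LHS]/(genalg_val (h M) `&` genalg_val (h N)) !hK -subset0.
    move=> x [[_ [i Mi aix]] [_ [j' Nj ajx]]].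
    have [ij|/a_disj/(congr1 (@genalg_val _ _ F)) aij] := eqVneq i j'.
      have : (M `&` N) i by split => //; rewrite ij.
      by rewrite [M `&` N]MN.
    have : (genalg_val (a i) `&` genalg_val (a j')) x by [].
    by rewrite [_ `&` _]aij.
  rewrite -[LHS]/(genalg_val (h (M `|` N))).
  rewrite -[RHS]/(genalg_val (h M) `|` genalg_val (h N)) !hK.
  by rewrite bigcup_setU setIUr.
have hE : (fun j => m j (A `&` a j)%O) = fun j => (m j \o h) [set j].
  apply/funext => j /=; congr (m j _); apply: val_inj.
  by rewrite -[RHS]/(genalg_val (h [set j])) hK bigcup_set1.
by rewrite hE; apply: (phillips_diagonal hP) => M; exact: m0.
Qed.

End filter_algebra.

(** * A bounded, pointwise null sequence that is not weakly null *)

Theorem theoremE (R : realType) (F : set_system nat) (hF : free_filter F) :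
  ~ nikodym_property R (filter_algebra F) ->
  ~ grothendieck_property R (filter_algebra F).
Proof.
move=> /existsNP[mu /not_implyP[mu0 mu_unb]] groth.
have [FF _] := hF.
have [s0 [a0 [s0I a0_disj a0_ge1]]] := unbounded_disjoint_sequence mu0 mu_unb.
(* Two disjoint sets cannot both belong to [F], so a tail of [a0] avoids it. *)
have [K aK] : exists K, forall j, F (~` genalg_val (a0 (j + K)%N)).
  have [[i Fi]|nF] := pselect (exists i, F (genalg_val (a0 i))).
    exists i.+1 => j; have [Fj|//] := filter_algebra_cases FF (a0 (j + i.+1)%N).
    have ij : i != (j + i.+1)%N by rewrite neq_ltn -ltnS addnS ltnS ltnS leq_addl.
    have aij := congr1 (@genalg_val _ _ F) (a0_disj _ _ ij).
    by have := filter_disjoint FF aij Fi Fj.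
  exists 0%N => j; have [Fj|//] := filter_algebra_cases FF (a0 (j + 0)%N).
  by case: nF; exists (j + 0)%N.
pose a j := a0 (j + K)%N; pose m j := mu (s0 (j + K)%N).
have a_disj i j : i != j -> (a i `&` a j)%O = \bot%O.
  by move=> ij; apply: a0_disj; rewrite eqn_add2r.
have m0 : pointwise_null m.
  move=> A; have sI : {homo (fun j => s0 (j + K)%N) : i j / (i < j)%N}.
    by move=> i j ij; apply: s0I; rewrite ltn_add2r.
  exact: (cvg_comp _ _ (homo_ltn_cvg sI) (mu0 A)).
pose r j := restr_ba (m j) (a j).
have rE j A : r j A = m j (A `&` a j)%O by [].
have r_ge1 j : 1 <= `|r j|.
  rewrite (le_trans _ (norm_le_variation (a j) (baP (r j))))// rE meetxx.
  exact: a0_ge1.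
have r_gt0 j : 0 < `|r j| by exact: lt_le_trans (r_ge1 j).
have r_null A : F (~` genalg_val A) -> r j A @[j --> \oo] --> (0 : R).
  exact: disjoint_diagonal_null.
pose delta : ba R (filter_algebra F) := filter_ba FF.
have delta0 A : F (~` genalg_val A) -> delta A = 0.
  move=> FA; rewrite /= /filter_charge asboolF// => FA'.
  by apply: filter_disjoint FA' FA => //; rewrite setICr.
have delta1 A : F (genalg_val A) -> delta A = 1.
  by move=> FA; rewrite /= /filter_charge asboolT.
pose nu j := `|r j|^-1 *: (r j - r j \top%O *: delta).
have nuE j A : nu j A = `|r j|^-1 * (r j A - r j \top%O * delta A).
  by [].
have nu_bounded : norm_bounded nu.
  exists (1 + `|delta|) => j.
  rewrite normrZ normfV normr_id ler_pdivrMl// mulrDr mulr1.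
  rewrite (le_trans (ler_normB _ _))// lerD2l normrZ ler_wpM2r//.
  exact: norm_le_variation (baP _).
have nu_null : pointwise_null nu.
  have small A (f : nat -> R) : F (~` genalg_val A) ->
      (forall j, `|f j| <= `|r j A|) -> f j @[j --> \oo] --> (0 : R).
    move=> FA fr; apply/norm_cvg0P.
    apply: (@squeeze_cvgr _ _ _ _ (fun=> 0) (fun j => `|r j A|)).
    - by near=> j; rewrite fr normr_ge0.
    - exact: cvg_cst.
    - by apply/norm_cvg0P; exact: r_null.
  have rV j x : `| `|r j|^-1 * x| <= `|x|.
    by rewrite normrM normfV normr_id ler_piMl// invf_le1.
  (* For [A] in [F] the [delta] term turns [r j A] into minus the value of [r j] at the complement
     of [A], which lies in the dual ideal. *)
  move=> A; have [FA|FA] := filter_algebra_cases FF A.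
    apply: (small (~` A)%O) => [|j].
      by rewrite genalg_valC complEset setCK.
    rewrite nuE delta1// mulr1 (le_trans (rV _ _))//.
    have [rD _] := baP (r j).
    rewrite (finitely_additive_split A \top%O rD) !meet1x opprD addrA subrr add0r.
    by rewrite normrN.
  apply: (small A) => // j.
  by rewrite nuE delta0// mulr0 subr0 rV.
have /choice[b0 b0P] j := ba_quarter_norm_attained (r j).
(* Cutting down to [a j] makes the elements disjoint and leaves the value of [r j] unchanged. *)
pose b j := (b0 j `&` a j)%O.
have b_disj i j : i != j -> (b i `&` b j)%O = \bot%O.
  by move=> ij; rewrite meetACA a_disj// meetx0.
have rb j : r j (b j) = r j (b0 j) by rewrite !rE -meetA meetxx.
have sg1 j : `|Num.sg (r j (b j))| <= 1.
  by rewrite normr_sg; case: (_ == _).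
have [phi phi_cont phiE] := disjoint_series_functional b_disj sg1.
have phi_nu j : 4^-1 <= phi (nu j).
  (* [delta] vanishes on every [b i], and [r j] vanishes on [b i] for [i != j], so only one term of
     the series survives. *)
  have nub i : nu j (b i) = (i == j)%:R * (`|r j|^-1 * r j (b j)).
    have Fb : F (~` genalg_val (b i)).
      by apply: filterS (aK i) => x nax [_ /nax].
    rewrite nuE delta0// mulr0 subr0; have [->|ij] := eqVneq i j.
      by rewrite mul1r.
    have [rD _] := baP (m j).
    by rewrite mul0r rE -meetA a_disj// meetx0 finitely_additive0// mulr0.
  have termE : (fun i => Num.sg (r i (b i)) * nu j (b i)) =
      (fun i => (i == j)%:R * (`|r j|^-1 * `|r j (b j)|)).
    apply/funext => i; rewrite nub; have [->|_] := eqVneq i j.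
      by rewrite !mul1r mulrCA -normrEsg.
    by rewrite !mul0r mulr0.
  rewrite phiE termE (_ : limn _ = `|r j|^-1 * `|r j (b j)|).
    by rewrite ler_pdivlMl// rb.
  apply: cvg_lim => //; apply: cvg_near_cst; exists j.+1 => // n /= jn.
  rewrite seriesEord /= (bigD1 (Ordinal jn))//= eqxx mul1r big1 ?addr0//.
  by move=> i; rewrite -val_eqE /= => /negPf ->; rewrite mul0r.
have /cvgr0Pnorm_lt/(_ 4^-1)[|N _ /(_ N (leqnn N))] :=
  groth nu nu_bounded nu_null phi phi_cont.
  by rewrite invr_gt0.
by rewrite ltNge (le_trans (phi_nu N) (ler_norm _)).
Unshelve. all: by end_near. Qed.
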